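(* For all $a,b,c\in2\mathbb N$ and every integer $n\ge2$, $$\Phi_n\begin{pmatrix}a&c\\ b&0\end{pmatrix}=\frac{(n-1)!!}{(n-2)!!}\cdot\frac{(a+c+n-2)!!\,(b+c+n-2)!!}{(c+n-2)!!\,(a+b+c+n-1)!!}.$$
   Context: Double factorial convention (non-standard): for an integer $m\ge0$, $m!!=(m-1)(m-3)\cdots$, the product of the positive integers $\le m-1$ of the parity of $m-1$ (empty product $=1$). For a $2\times q$ matrix with nonnegative integer entries and $n\ge\max(2,q)$, $I_n\begin{pmatrix}{\bf a}\\{\bf b}\end{pmatrix}=\int_{O_n}\prod_j u_{1j}^{a_j}u_{2j}^{b_j}\,du$ (Haar probability measure on $O_n$) and $\Phi_n\begin{pmatrix}{\bf a}\\ {\bf b}\end{pmatrix}=\frac{(\Sigma a_i+n-2)!!\,(\Sigma b_i+n-2)!!}{(n-2)!!^2\,\prod a_i!!\,\prod b_i!!}\,I_n\begin{pmatrix}{\bf a}\\ {\bf b}\end{pmatrix}$. *)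

(* Defs.v *)
From HB Require Import structures.
From mathcomp Require Import all_boot all_order all_algebra.
From mathcomp Require Import all_classical all_reals all_analysis.
Set Implicit Arguments. Unset Strict Implicit. Unset Printing Implicit Defensive.
Import Order.TTheory GRing.Theory Num.Theory.
Local Open Scope classical_set_scope.
Local Open Scope ring_scope.

(* Non-standard double factorial of the paper:
   m!! = (m-1)(m-3)... (positive integers <= m-1 of the parity of m-1),
   empty product = 1.  So 0!! = 1!! = 1 and (m+2)!! = (m+1) * m!!. *)
Fixpoint dfact (m : nat) : nat :=
  match m with
  | 0 => 1
  | 1 => 1
  | m'.+2 => (m'.+1 * dfact m')%N
  end.

Section Haar.
Variable R : realType.

(* sigma-algebra on n x n real matrices generated by the coordinate maps
   (= the Borel sigma-algebra of R^(n*n)) *)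
Definition mxT (n : nat) : Type := 'M[R]_n.
HB.instance Definition _ (n : nat) := Choice.on (mxT n).
HB.instance Definition _ (n : nat) := isPointed.Build (mxT n) (0 : 'M[R]_n).

Definition mx_coord_gen (n : nat) : set (set (mxT n)) :=
  [set A | exists (i j : 'I_n) (B : set R),
      measurable B /\ A = (fun M : mxT n => (M : 'M[R]_n) i j) @^-1` B].

Definition mxMeas (n : nat) := g_sigma_algebraType (@mx_coord_gen n).

Definition orth_group (n : nat) : set (mxMeas n) :=
  [set M : 'M[R]_n | M *m M^T = 1%:M].
Arguments orth_group n : clear implicits.

(* mu is the Haar probability measure of O_n: a probability measure
   concentrated on O_n and invariant under left multiplication by O_n
   (such a measure is unique). *)
Definition is_Haar_On (n : nat) (mu : probability (mxMeas n) R) : Prop :=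
  mu (orth_group n) = 1%E /\
  forall Q : 'M[R]_n, orth_group n Q ->
    forall A : set (mxMeas n), measurable A ->
      mu ((fun M : mxMeas n => (Q *m M : mxMeas n)) @^-1` A) = mu A.

Definition ent (n : nat) (M : 'M[R]_n) (i j : nat) : R :=
  match @insub nat (fun k => (k < n)%N) 'I_n i,
        @insub nat (fun k => (k < n)%N) 'I_n j with
  | Some i', Some j' => M i' j'
  | _, _ => 0
  end.

(* I_n (a ; b) for the 2 x q matrix with rows a, b (q = size a; b is read
   with default 0): integral over O_n of prod_j u_{1j}^{a_j} u_{2j}^{b_j}.
   Rows 1,2 of the paper are the 0-based rows 0,1. *)
Definition I_int (n : nat) (mu : probability (mxMeas n) R)
    (a b : seq nat) : \bar R :=
  (\int[mu]_(M in orth_group n)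
     (\prod_(j < size a)
        (ent M 0 j ^+ nth 0%N a j * ent M 1 j ^+ nth 0%N b j))%:E)%E.

Definition Phi (n : nat) (mu : probability (mxMeas n) R)
    (a b : seq nat) : \bar R :=
  ((((dfact (sumn a + n - 2))%:R * (dfact (sumn b + n - 2))%:R)
     / ((dfact (n - 2))%:R ^+ 2
        * (\prod_(x <- a) (dfact x)%:R) * (\prod_(x <- b) (dfact x)%:R)))%:E
   * I_int mu a b)%E.

End Haar.

(* Main.v *)
Require Import Defs.
From HB Require Import structures.
From mathcomp Require Import all_boot all_order all_algebra.
From mathcomp Require Import all_classical all_reals all_analysis.
From mathcomp Require Import measurable_realfun ring zify.
Import Order.TTheory GRing.Theory Num.Theory.
Local Open Scope ring_scope.

(** Let K(a,b,c) be the integral of u_00^a u_01^b u_10^c over O_n.  Invariance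
    under rotations of two rows i, j other than row 0 gives
    E[F (u_i0 + t u_j0)^(2h)] = (1 + t^2)^h E[F u_i0^(2h)] for every F depending
    on the other rows only.  The coefficients of t^2 yield
    (2h-1) E[F u_i0^(2h-2) u_j0^2] = E[F u_i0^(2h)], and summing over j, with
    column 0 of norm 1, gives
      (c+1) (K(a,b,c) - K(a+2,b,c)) = (n-1+c) K(a,b,c+2)   for c even.
    Letting row 0 take part in the rotations gives in the same way
    (a+1) K(a,0,0) = (n+a) K(a+2,0,0).  Finally left invariance implies invariance
    under transposition, so that K(a,b,c) = K(a,c,b), and these relations
    determine K at even arguments. *)

(** * Polynomial identities and reflections *)

Lemma poly_horner_inj (R : numDomainType) (p q : {poly R}) :
  (forall t, p.[t] = q.[t]) -> p = q.
Proof.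
move=> pq; apply/eqP; rewrite -subr_eq0; apply/eqP.
(* Naturals stay distinct in a numeric domain, so [p - q] gets more roots than its degree allows. *)
pose rs : seq R := [seq k%:R | k <- iota 0 (size (p - q)).+1].
apply: (@roots_geq_poly_eq0 _ _ rs); last by rewrite size_map size_iota.
  by apply/allP => t _; rewrite rootE hornerD hornerN pq subrr.
by rewrite map_inj_uniq ?iota_uniq// => k l /eqP; rewrite eqr_nat => /eqP.
Qed.

Lemma coef2_exp_add1X2 (R : comNzRingType) h :
  ((1 + 'X^2 : {poly R}) ^+ h)`_2 = h%:R.
Proof.
suff [//] : ((1 + 'X^2 : {poly R}) ^+ h)`_2 = h%:R /\
            ((1 + 'X^2 : {poly R}) ^+ h)`_0 = 1.
elim: h => [|h [IH2 IH0]]; first by rewrite expr0 !coef1.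
by rewrite exprS mulrDl mul1r !coefD !coefXnM /= IH2 IH0 addr0 -natr1.
Qed.

(* Up to the sign of r, which even powers do not see, this is the action of a
   rotation; the reflection along the vector w below is easier to build. *)
Lemma orthogonal_reflection (R : realType) (n : nat) (i j : 'I_n) (t : R) :
  i != j ->
  exists2 Q : 'M[R]_n, @orth_group R n Q &
    exists2 r : R, r ^+ 2 * (1 + t ^+ 2) = 1 &
    forall (M : 'M[R]_n) l, (Q *m M) i l = r * (M i l + t * M j l) /\
      forall k, k != i -> k != j -> (Q *m M) k l = M k l.
Proof.
move=> ij.
have t_gt0 : 0 < 1 + t ^+ 2 by rewrite ltr_wpDr ?sqr_ge0.
pose al := (Num.sqrt (1 + t ^+ 2))^-1.
have al_gt0 : 0 < al by rewrite invr_gt0 sqrtr_gt0.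
have al2 : al ^+ 2 * (1 + t ^+ 2) = 1.
  by rewrite exprVn sqr_sqrtr ?(ltW t_gt0)// mulVf// gt_eqF.
(* [w] is the difference of the unit vectors e_i and -al (e_i + t e_j), which the reflection along
   [w] therefore swaps. The minus sign makes the squared norm of [w] equal to 2 (1 + al), never
   zero, so that [c] below is 2 divided by that squared norm. *)
pose w : 'cV[R]_n := \col_k ((1 + al) *+ (k == i) + (al * t) *+ (k == j)).
have wM (A : 'cV[R]_n) : w^T *m A = ((1 + al) * A i 0 + al * t * A j 0)%:M.
  apply/matrixP => x y; rewrite !ord1 mxE [RHS]mxE eqxx mulr1n.
  under eq_bigr => k _ do rewrite 2!mxE mulrDl !mulrb !(fun_if ( *%R^~ _)) !mul0r.
  by rewrite big_split/= -!big_mkcond !big_pred1_eq.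
have ww : w^T *m w = (2 * (1 + al))%:M.
  rewrite wM !mxE !eqxx (negPf ij) eq_sym (negPf ij) !mulr1n !mulr0n addr0 add0r.
  congr (_%:M); rewrite -[RHS]addr0.
  suff <- : al ^+ 2 * (1 + t ^+ 2) - 1 = 0 by ring.
  by rewrite al2 subrr.
pose c := (1 + al)^-1.
have c_unit : c * (1 + al) = 1 by rewrite mulVf// gt_eqF// addr_gt0.
pose Q : 'M[R]_n := 1%:M - c *: (w *m w^T).
exists Q.
  have QT : Q^T = Q by rewrite /Q linearB/= linearZ/= trmx_mul trmxK trmx1.
  rewrite /orth_group/= QT /Q mulmxBl mul1mx mulmxBr mulmx1.
  rewrite -!scalemxAl -!scalemxAr mulmxA -(mulmxA w) ww mul_mx_scalar.
  rewrite -scalemxAl !scalerA (mulrCA c 2) c_unit.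
  by rewrite mulr1 mulr_natr -scalerMnl mulr2n opprB addrK subrK.
exists (- al); first by rewrite sqrrN.
move=> M l.
have QM k : (Q *m M) k l = M k l - c * (w k 0 * ((1 + al) * M i l + al * t * M j l)).
  rewrite mulmxBl mul1mx -scalemxAl -mulmxA !mxE; congr (_ - c * _).
  rewrite big_ord1; congr (_ * _); first by rewrite mxE.
  have /matrixP/(_ 0 0) := wM (col l M).
  rewrite mxE [X in _ = X]mxE eqxx mulr1n ![col _ _ _ _]mxE => <-; rewrite mxE.
  by apply: eq_bigr => m _; rewrite !mxE.
split.
  rewrite QM mxE eqxx (negPf ij) mulr1n mulr0n addr0.
  by rewrite mulrA c_unit; ring.
by move=> k ki kj; rewrite QM mxE (negPf ki) (negPf kj) !mulr0n addr0 mul0r mulr0 subr0.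
Qed.

(** * Measurability and boundedness on the orthogonal group *)

Section OrthogonalIntegral.
Local Open Scope classical_set_scope.
Context (R : realType) (n : nat).
Implicit Types (f g : mxMeas R n -> R) (M N Q : 'M[R]_n).

Local Notation On := (@orth_group R n).

Lemma measurable_entry (i j : 'I_n) :
  measurable_fun setT (fun M : mxMeas R n => (M : 'M[R]_n) i j).
Proof.
move=> _ B mB; rewrite setTI; apply: sub_sigma_algebra.
by exists i, j, B.
Qed.

Lemma measurable_fun_matrix d (T : measurableType d) (phi : T -> mxMeas R n) :
  (forall i j, measurable_fun setT (fun x => (phi x : 'M[R]_n) i j)) ->
  measurable_fun setT phi.
Proof.
move=> mphi; apply: (@measurability _ _ T (mxMeas R n) setT phi (@mx_coord_gen R n)) => //.
move=> _ [_ [i [j [B [mB ->]]]] <-].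
by rewrite setTI -comp_preimage -[X in measurable X]setTI; apply: mphi.
Qed.

Lemma measurable_fun_mulmx d (T : measurableType d) (phi psi : T -> mxMeas R n) :
  measurable_fun setT phi -> measurable_fun setT psi ->
  measurable_fun setT (fun x => (phi x : 'M[R]_n) *m psi x : mxMeas R n).
Proof.
move=> mphi mpsi; apply: measurable_fun_matrix => i j.
under eq_fun do rewrite mxE.
apply: measurable_sum => k; apply: measurable_funM.
  exact: (measurableT_comp (measurable_entry i k) mphi).
exact: (measurableT_comp (measurable_entry k j) mpsi).
Qed.

Lemma measurable_trmx :
  measurable_fun setT (fun M : mxMeas R n => (M : 'M[R]_n)^T : mxMeas R n).
Proof.
apply: measurable_fun_matrix => i j; under eq_fun do rewrite mxE.
exact: measurable_entry.
Qed.

Lemma measurable_orth_group : measurable On.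
Proof.
(* Encodes the matrix equation as the vanishing of one measurable real function. *)
pose dist (M : mxMeas R n) : R :=
  \sum_i \sum_j `|((M : 'M[R]_n) *m (M : 'M[R]_n)^T) i j - (1%:M : 'M[R]_n) i j|.
have mdist : measurable_fun setT dist.
  apply: measurable_sum => i; apply: measurable_sum => j.
  apply: measurableT_comp => //; apply: measurable_funB => //.
  apply: (measurableT_comp (measurable_entry i j)).
  apply: measurable_fun_mulmx => //; exact: measurable_trmx.
have -> : On = dist @^-1` [set 0].
  apply/seteqP; split => M; rewrite /orth_group /= /dist.
    by move=> ->; rewrite big1// => i _; rewrite big1// => j _; rewrite subrr normr0.
  move/eqP; rewrite psumr_eq0 => [/allP d0|i _]; last exact: sumr_ge0.
  apply/matrixP => i j; apply/eqP; rewrite -subr_eq0 -normr_eq0.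
  have := d0 i (mem_index_enum _); rewrite implyTb psumr_eq0//.
  by move=> /allP/(_ j (mem_index_enum _)); rewrite implyTb.
by rewrite -[X in measurable X]setTI; apply: mdist.
Qed.

Lemma orth_group_mulTmx M : On M -> M^T *m M = 1%:M.
Proof. by rewrite /orth_group/= => /mulmx1C. Qed.

Lemma orth_group_tr M : On M -> On M^T.
Proof. by move=> OM; rewrite /orth_group/= trmxK; exact: orth_group_mulTmx. Qed.

Lemma orth_group_mul M N : On M -> On N -> On (M *m N).
Proof.
rewrite /orth_group/= => OM ON.
by rewrite trmx_mul mulmxA -(mulmxA M) ON mulmx1.
Qed.

Lemma orth_row_sum M i : On M -> \sum_j M i j ^+ 2 = 1.
Proof.
move=> OM; have : (M *m M^T) i i = 1 by rewrite OM mxE eqxx.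
by rewrite mxE => <-; apply: eq_bigr => j _; rewrite mxE expr2.
Qed.

Lemma orth_entry_le1 M i j : On M -> `|M i j| <= 1.
Proof.
move=> /(orth_row_sum M i) s1; rewrite -(@ler_sqr _ `|_| 1) ?nnegrE//.
rewrite expr1n real_normK ?num_real// -s1 (bigD1 j)//= lerDl.
by apply: sumr_ge0 => k _; rewrite sqr_ge0.
Qed.

(** The bound is asked only on the group, since monomials in the entries are unbounded on all
    matrices. The class is stable under sums, products and orthogonal translations, and its members
    are integrable on [On]. *)
Definition orth_bounded f :=
  measurable_fun setT f /\ exists C, forall M, On M -> `|f M| <= C.

Lemma orth_bounded_cst r : orth_bounded (fun=> r).
Proof. by split => //; exists `|r|. Qed.

Lemma orth_bounded_entry i j : orth_bounded (fun M => (M : 'M[R]_n) i j).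
Proof.
by split; [exact: measurable_entry|exists 1 => M; exact: orth_entry_le1].
Qed.

Lemma orth_boundedD f g :
  orth_bounded f -> orth_bounded g -> orth_bounded (fun M => f M + g M).
Proof.
move=> [mf [C fC]] [mg [C' gC']]; split; first exact: measurable_funD.
by exists (C + C') => M OM; rewrite (le_trans (ler_normD _ _))// lerD ?fC ?gC'.
Qed.

Lemma orth_boundedM f g :
  orth_bounded f -> orth_bounded g -> orth_bounded (fun M => f M * g M).
Proof.
move=> [mf [C fC]] [mg [C' gC']]; split; first exact: measurable_funM.
by exists (C * C') => M OM; rewrite normrM ler_pM ?fC ?gC'.
Qed.

Lemma orth_boundedX f k : orth_bounded f -> orth_bounded (fun M => f M ^+ k).
Proof.
move=> bf; elim: k => [|k IHk]; first exact: orth_bounded_cst.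
by under eq_fun do rewrite exprS; exact: orth_boundedM.
Qed.

Lemma orth_bounded_sum (I : Type) (s : seq I) (F : I -> mxMeas R n -> R) :
  (forall i, orth_bounded (F i)) -> orth_bounded (fun M => \sum_(i <- s) F i M).
Proof.
move=> bF; elim: s => [|i s IHs].
  by under eq_fun do rewrite big_nil; exact: orth_bounded_cst.
by under eq_fun do rewrite big_cons; exact: orth_boundedD.
Qed.

Lemma orth_bounded_comp f (phi : mxMeas R n -> mxMeas R n) :
  measurable_fun setT phi -> (forall M, On M -> On (phi M)) ->
  orth_bounded f -> orth_bounded (fun M => f (phi M)).
Proof.
move=> mphi Ophi [mf [C fC]]; split; first exact: measurableT_comp.
by exists C => M OM; exact/fC/Ophi.
Qed.

(** * Integration against the Haar measure and its invariance *)

Context (mu : probability (mxMeas R n) R) (hmu : is_Haar_On mu).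

Let Ex f := \int[mu]_(M in On) f M.

Lemma orth_bounded_integrable f :
  orth_bounded f -> mu.-integrable On (EFin \o f).
Proof.
move=> [mf [C fC]]; apply: measurable_bounded_integrable.
- exact: measurable_orth_group.
- by rewrite [X in (X < _)%E]hmu.1 ltry.
- exact: measurable_funTS.
- exists C; split; first exact: num_real.
  by move=> r Cr M OM; exact: le_trans (fC _ OM) (ltW Cr).
Qed.

Lemma Ex_cst r : Ex (fun=> r) = r.
Proof.
rewrite /Ex Rintegral_cst; last exact: measurable_orth_group.
by rewrite [X in fine X]hmu.1 mulr1.
Qed.

Lemma ExD f g : orth_bounded f -> orth_bounded g ->
  Ex (fun M => f M + g M) = Ex f + Ex g.
Proof.
by move=> bf bg; apply: RintegralD; [exact: measurable_orth_group|
  exact: orth_bounded_integrable..].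
Qed.

Lemma ExZ r f : orth_bounded f -> Ex (fun M => r * f M) = r * Ex f.
Proof.
by move=> bf; apply: RintegralZl; [exact: measurable_orth_group|
  exact: orth_bounded_integrable].
Qed.

Lemma Ex_sum (I : Type) (s : seq I) (F : I -> mxMeas R n -> R) :
  (forall i, orth_bounded (F i)) ->
  Ex (fun M => \sum_(i <- s) F i M) = \sum_(i <- s) Ex (F i).
Proof.
move=> bF; elim: s => [|i s IHs].
  by under [Ex _]eq_Rintegral do rewrite big_nil; rewrite big_nil; exact: Ex_cst.
under [Ex _]eq_Rintegral do rewrite big_cons.
by rewrite big_cons -IHs; apply: ExD => //; exact: orth_bounded_sum.
Qed.

Lemma eq_Ex f g : (forall M, On M -> f M = g M) -> Ex f = Ex g.
Proof. by move=> fg; apply: eq_Rintegral => M; rewrite inE => /fg. Qed.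

(** Change of variables: [mu] equals its pushforward under left multiplication by [Q], and the
    preimage of [On] under this map is [On] itself. *)
Lemma Ex_mulmx f Q : orth_bounded f -> On Q ->
  Ex (fun M => f ((Q : 'M[R]_n) *m M)) = Ex f.
Proof.
move=> bf OQ.
pose phi (M : mxMeas R n) : mxMeas R n := (Q : 'M[R]_n) *m M.
have mphi : measurable_fun setT phi by exact: measurable_fun_mulmx.
have Ophi : phi @^-1` On = On.
  apply/seteqP; split => M; rewrite /phi /= => OM; last exact: orth_group_mul.
  rewrite -[M]mul1mx -(orth_group_mulTmx _ OQ) -mulmxA.
  by apply: orth_group_mul => //; exact: orth_group_tr.
have mOn := measurable_orth_group.
have iphi : mu.-integrable (phi @^-1` On) ((EFin \o f) \o phi).
  rewrite Ophi; apply: orth_bounded_integrable; apply: orth_bounded_comp => //.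
  by move=> M OM; exact: orth_group_mul.
have [mf _] := bf.
have mEf : measurable_fun setT (EFin \o f) by exact/measurable_EFinP.
rewrite /Ex /Rintegral; congr fine.
rewrite [RHS](eq_measure_integral (pushforward mu phi)).
  by rewrite (integral_pushforward mphi mEf iphi mOn) Ophi.
by move=> A mA _; exact: (esym (hmu.2 Q OQ A mA)).
Qed.

(* Integrating f(N^T M) over both N and M gives the integral of f when M is
   integrated first, and that of f(M^T) when N is, by left invariance. *)
Lemma Ex_trmx f : orth_bounded f ->
  Ex (fun M => f ((M : 'M[R]_n)^T : mxMeas R n)) = Ex f.
Proof.
move=> bf.
have mOn := measurable_orth_group.
(* The indicators move the domain into the integrand, so that Fubini applies on the full product
   space. *)
pose h (z : mxMeas R n * mxMeas R n) : R :=
  \1_On z.1 * (\1_On z.2 * f ((z.1 : 'M[R]_n)^T *m (z.2 : 'M[R]_n))).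
have mfst : measurable_fun [set: mxMeas R n * mxMeas R n] fst by exact: measurable_fst.
have msnd : measurable_fun [set: mxMeas R n * mxMeas R n] snd by exact: measurable_snd.
have m1 : measurable_fun setT (\1_On : mxMeas R n -> R) by exact: measurable_indic.
have mh : measurable_fun setT h.
  apply: measurable_funM.
    exact: (measurableT_comp m1 mfst).
  apply: measurable_funM.
    exact: (measurableT_comp m1 msnd).
  apply: (measurableT_comp bf.1 (measurable_fun_mulmx _ _ _ _ _ _)) => //.
  exact: (measurableT_comp measurable_trmx).
have m12 : ((mu \x mu)%E : set (mxMeas R n * mxMeas R n) -> \bar R) setT = 1%E.
  by rewrite -setXTT product_measure1E//= ![mu setT]probability_setT mule1.
have ih : (mu \x mu)%E.-integrable setT (EFin \o h).
  apply: measurable_bounded_integrable => //.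
    by rewrite [X in (X < _)%E]m12 ltry.
  have [_ [C fC]] := bf.
  exists `|C|; split; first exact: num_real.
  move=> r Cr [M N] _; rewrite /h /= !indicE; apply: le_trans (ltW Cr).
  have [/set_mem OM|_] := boolP (M \in On); last by rewrite mul0r normr0.
  have [/set_mem ON|_] := boolP (N \in On); last by rewrite mul0r mulr0 normr0.
  rewrite !mul1r (le_trans (fC _ _)) ?ler_norm//.
  exact/orth_group_mul/ON/orth_group_tr.
have inner (g : mxMeas R n -> R) : orth_bounded g ->
    (\int[mu]_N (\1_On N * g N)%:E = (Ex g)%:E)%E.
  move=> bg; rewrite /Ex /Rintegral fineK; last first.
    by apply: integrable_fin_num => //; exact: orth_bounded_integrable.
  rewrite [RHS]integral_mkcond; apply: eq_integral => M _.
  by rewrite patchE indicE; case: (boolP (M \in On)); rewrite (mul1r, mul0r).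
(* The hypothesis on [g] is conditional because both sides vanish when [N] lies outside the
   group. *)
have slice (N : mxMeas R n) (g : mxMeas R n -> R) c :
    (On N -> orth_bounded g /\ Ex g = c) ->
    (\int[mu]_M (\1_On N * (\1_On M * g M))%:E = (\1_On N * c)%:E)%E.
  rewrite indicE; case: (boolP (N \in On)) => [/set_mem ON|_] gc.
    have [bg <-] := gc ON; rewrite mul1r -inner//.
    by apply: eq_integral => M _; rewrite mul1r.
  by rewrite mul0r -[RHS](integral0 mu setT); apply: eq_integral => M _; rewrite mul0r.
have outer c : (\int[mu]_N (\1_On N * c)%:E = c%:E)%E.
  by rewrite (inner _ (orth_bounded_cst c)) Ex_cst.
have btr : orth_bounded (fun M => f ((M : 'M[R]_n)^T : mxMeas R n)).
  by apply: orth_bounded_comp bf => //; [exact: measurable_trmx|exact: orth_group_tr].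
have bmul N (g : mxMeas R n -> R) : On N -> orth_bounded g ->
    orth_bounded (fun M => g ((N : 'M[R]_n) *m M)).
  move=> ON bg; apply: orth_bounded_comp bg; first exact: measurable_fun_mulmx.
  by move=> M; exact: orth_group_mul.
have left_avg N : (\int[mu]_M (h (N, M))%:E = (\1_On N * Ex f)%:E)%E.
  apply: slice => ON; have OtN := orth_group_tr _ ON.
  by split; [exact: (bmul _ f OtN)|exact: (Ex_mulmx _ _ bf OtN)].
have right_avg M : (\int[mu]_N (h (N, M))%:E =
    (\1_On M * Ex (fun M => f ((M : 'M[R]_n)^T : mxMeas R n)))%:E)%E.
  rewrite -(slice M (fun N => f ((N : 'M[R]_n)^T *m (M : 'M[R]_n)))).
    by apply: eq_integral => N _; rewrite /h/= mulrCA.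
  move=> OM; have OtM := orth_group_tr _ OM.
  (* With [M] fixed, N^T M = (M^T N)^T exhibits a left translate of the transposed function. *)
  have -> : (fun N : mxMeas R n => f ((N : 'M[R]_n)^T *m M)) =
            (fun N => f (((M : 'M[R]_n)^T *m N)^T : 'M[R]_n)).
    by apply/funext => N; rewrite trmx_mul trmxK.
  by split; [exact: (bmul _ _ OtM btr)|exact: (Ex_mulmx _ _ btr OtM)].
have := Fubini ih.
have -> : (\int[mu]_N \int[mu]_M (EFin \o h) (N, M) = (Ex f)%:E)%E.
  by rewrite -outer; apply: eq_integral => N _; exact: left_avg.
have -> : (\int[mu]_M \int[mu]_N (EFin \o h) (N, M) =
    (Ex (fun M => f ((M : 'M[R]_n)^T : mxMeas R n)))%:E)%E.
  by rewrite -outer; apply: eq_integral => M _; exact: right_avg.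
by case.
Qed.

(** * Moment recursions from mixing two rows *)

Lemma Ex_rotation (i j l : 'I_n) (F : mxMeas R n -> R) h t :
    i != j -> orth_bounded F ->
    (forall M N : 'M[R]_n,
      (forall k m, k != i -> k != j -> M k m = N k m) -> F M = F N) ->
  Ex (fun M => F M * ((M : 'M[R]_n) i l + t * (M : 'M[R]_n) j l) ^+ h.*2) =
  (1 + t ^+ 2) ^+ h * Ex (fun M => F M * (M : 'M[R]_n) i l ^+ h.*2).
Proof.
move=> ij bF indF; have [Q OQ [r r2 QE]] := orthogonal_reflection R n i j t ij.
have bX k : orth_bounded (fun M => (M : 'M[R]_n) k l) by exact: orth_bounded_entry.
have bFX : orth_bounded (fun M => F M * (M : 'M[R]_n) i l ^+ h.*2).
  by apply: orth_boundedM => //; exact: orth_boundedX.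
rewrite -(Ex_mulmx _ _ bFX OQ) -ExZ; last first.
  apply: (orth_bounded_comp _ (fun M => Q *m M)) bFX => //.
    exact: measurable_fun_mulmx.
  by move=> M; exact: orth_group_mul.
apply: eq_Ex => M _; rewrite (QE M l).1 (indF (Q *m M) M); last first.
  by move=> k m; exact: (QE M m).2.
(* The even exponent leaves only r^2, the inverse of 1 + t^2. *)
rewrite -!mul2n !exprM mulrCA; congr (_ * _).
by rewrite -[RHS]exprMn; congr (_ ^+ h); rewrite exprMn mulrA [(1 + _) * _]mulrC r2 mul1r.
Qed.

(** Compare the coefficients of t^2 in [Ex_rotation] at exponent h + 1: the binomial coefficient
    (h+1)(2h+1) stands on one side, h + 1 on the other, and h + 1 cancels. *)
Lemma Ex_mixed_moment (i j l : 'I_n) (F : mxMeas R n -> R) h :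
    i != j -> orth_bounded F ->
    (forall M N : 'M[R]_n,
      (forall k m, k != i -> k != j -> M k m = N k m) -> F M = F N) ->
  h.*2.+1%:R * Ex (fun M => F M * ((M : 'M[R]_n) i l ^+ h.*2 * (M : 'M[R]_n) j l ^+ 2)) =
  Ex (fun M => F M * (M : 'M[R]_n) i l ^+ h.*2.+2).
Proof.
move=> ij bF indF.
pose G k (M : mxMeas R n) :=
  F M * ((M : 'M[R]_n) i l ^+ (h.*2.+2 - k) * (M : 'M[R]_n) j l ^+ k).
have bG k : orth_bounded (G k).
  apply: orth_boundedM => //; apply: orth_boundedM;
    by apply: orth_boundedX; exact: orth_bounded_entry.
(* The left side of [Ex_rotation], expanded by the binomial formula as a polynomial in t. *)
pose p := \poly_(k < h.*2.+3) (Ex (G k) *+ 'C(h.*2.+2, k)).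
have /(congr1 (fun q : {poly R} => q`_2)) : p = Ex (G 0%N) *: (1 + 'X^2) ^+ h.+1.
  apply: poly_horner_inj => t.
  rewrite hornerZ horner_exp hornerD hornerXn hornerC mulrC.
  have -> : Ex (G 0%N) = Ex (fun M => F M * (M : 'M[R]_n) i l ^+ h.+1.*2).
    by apply: eq_Ex => M _; rewrite /G subn0 mulr1.
  rewrite -(Ex_rotation i j l F h.+1 t ij bF indF) horner_poly.
  under [RHS]eq_Ex => M _ do rewrite exprDn mulr_sumr.
  rewrite Ex_sum => [|k].
    apply: eq_bigr => k _; transitivity ((t ^+ k *+ 'C(h.*2.+2, k)) * Ex (G k)).
      by rewrite !mulrnAl mulrC.
    rewrite -ExZ//; apply: eq_Ex => M _.
    by rewrite /G exprMn mulrnAl !mulrnAr; congr (_ *+ _); rewrite -[h.+1.*2]/(h.*2.+2); ring.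
  apply: orth_boundedM => //; under eq_fun do rewrite exprMn -mulr_natl.
  by do ?[apply: orth_boundedM|apply: orth_boundedX|
          exact: orth_bounded_entry|exact: orth_bounded_cst].
have -> : Ex (G 0%N) = Ex (fun M => F M * (M : 'M[R]_n) i l ^+ h.*2.+2).
  by apply: eq_Ex => M _; rewrite /G subn0 mulr1.
have -> : Ex (fun M => F M * ((M : 'M[R]_n) i l ^+ h.*2 * (M : 'M[R]_n) j l ^+ 2)) =
          Ex (G 2%N).
  by apply: eq_Ex => M _; rewrite /G !subSS subn0.
have bin : 'C(h.*2.+2, 2) = (h.+1 * h.*2.+1)%N.
  by rewrite bin2 -[h.*2.+2]/(h.+1.*2) -doubleMl doubleK.
rewrite coefZ coef2_exp_add1X2 coef_poly /= bin => e.
have h1 : h.+1%:R != 0 :> R by rewrite pnatr_eq0.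
by apply: (mulfI h1); rewrite mulrA -natrM mulr_natl e mulrC.
Qed.

(** [P] collects rows that [F] does not see. Since column [l] has norm 1, the parenthesis is the sum
    of squares over [P]. Each row of [P] other than [i] contributes the right-hand moment once by
    [Ex_mixed_moment], and row [i] contributes it 2h+1 times. *)
Lemma Ex_column_step (i l : 'I_n) (P : pred 'I_n) (F : mxMeas R n -> R) h :
    P i -> orth_bounded F ->
    (forall M N : 'M[R]_n,
      (forall k m, ~~ P k -> M k m = N k m) -> F M = F N) ->
  h.*2.+1%:R * Ex (fun M => F M * ((M : 'M[R]_n) i l ^+ h.*2 *
                  (1 - \sum_(k | ~~ P k) (M : 'M[R]_n) k l ^+ 2))) =
  (#|P| + h.*2)%:R * Ex (fun M => F M * (M : 'M[R]_n) i l ^+ h.*2.+2).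
Proof.
move=> Pi bF indF.
have bX k m e : orth_bounded (fun M => (M : 'M[R]_n) k m ^+ e).
  by apply: orth_boundedX; exact: orth_bounded_entry.
pose T k (M : mxMeas R n) := F M * ((M : 'M[R]_n) i l ^+ h.*2 * (M : 'M[R]_n) k l ^+ 2).
have bT k : orth_bounded (T k) by apply: orth_boundedM => //; exact: orth_boundedM.
have -> : Ex (fun M => F M * ((M : 'M[R]_n) i l ^+ h.*2 *
    (1 - \sum_(k | ~~ P k) (M : 'M[R]_n) k l ^+ 2))) =
    Ex (fun M => \sum_(k <- enum P) T k M).
  apply: eq_Ex => M OM; rewrite big_enum/= /T -!mulr_sumr; congr (_ * (_ * _)).
  have := orth_row_sum _ l (orth_group_tr _ OM); rewrite (bigID P)/=.
  under eq_bigr do rewrite mxE; under [X in _ + X]eq_bigr do rewrite mxE.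
  by move=> <-; rewrite addrK.
rewrite Ex_sum// big_enum/= mulr_sumr (bigD1 i)//=.
have TiE : Ex (T i) = Ex (fun M => F M * (M : 'M[R]_n) i l ^+ h.*2.+2).
  by apply: eq_Ex => M _; rewrite /T -exprD addn2.
rewrite (eq_bigr (fun=> Ex (T i))) => [|k /andP[Pk ki]]; last first.
  rewrite TiE; apply: Ex_mixed_moment; rewrite // 1?eq_sym//.
  move=> M N MN; apply: indF => m m' Pm; apply: MN; apply: contraNneq Pm => ->//.
rewrite TiE sumr_const -[X in _ + X = _]mulr_natl -mulrDl -natrD; congr (_%:R * _).
have -> : #|P| = #|[pred k | P k && (k != i)]|.+1.
  by rewrite (cardD1 i) [i \in P]Pi; congr _.+1; apply: eq_card => k; rewrite !inE andbC.
by rewrite addSnnS addnC.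
Qed.

(** * Relations between the moments of three corner entries *)

Context (i0 i1 : 'I_n) (i01 : i0 != i1).

Definition corner_moment (a b c : nat) : R :=
  Ex (fun M => (M : 'M[R]_n) i0 i0 ^+ a * (M : 'M[R]_n) i0 i1 ^+ b *
               (M : 'M[R]_n) i1 i0 ^+ c).

Let bX (k l : 'I_n) e : orth_bounded (fun M => (M : 'M[R]_n) k l ^+ e).
Proof. by apply: orth_boundedX; exact: orth_bounded_entry. Qed.

Let bK a b c : orth_bounded (fun M => (M : 'M[R]_n) i0 i0 ^+ a *
  (M : 'M[R]_n) i0 i1 ^+ b * (M : 'M[R]_n) i1 i0 ^+ c).
Proof. by apply: orth_boundedM => //; exact: orth_boundedM. Qed.

Lemma corner_momentC a b c : corner_moment a b c = corner_moment a c b.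
Proof.
rewrite /corner_moment -(Ex_trmx _ (bK a b c)); apply: eq_Ex => M _.
by rewrite !mxE mulrAC.
Qed.

Lemma corner_moment0 : corner_moment 0 0 0 = 1.
Proof. by rewrite -[RHS]Ex_cst; apply: eq_Ex => M _; rewrite !expr0 !mulr1. Qed.

(** The column step with F = 1 and [P] all [n] rows: no square is subtracted. *)
Lemma corner_moment_sphere a : ~~ odd a ->
  a.+1%:R * corner_moment a 0 0 = (n + a)%:R * corner_moment a.+2 0 0.
Proof.
move=> /even_halfK <-; set h := a./2.
have := Ex_column_step i0 i0 predT (fun=> 1) h isT (orth_bounded_cst 1) (fun _ _ _ => erefl).
rewrite cardT size_enum_ord => e.
have EK d : corner_moment d 0 0 = Ex (fun M => 1 * (M : 'M[R]_n) i0 i0 ^+ d).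
  by apply: eq_Ex => M _; rewrite !mulr1 mul1r.
rewrite !EK -e; congr (_ * _); apply: eq_Ex => M _.
by rewrite big_pred0// subr0 mulr1.
Qed.

(** The column step with [F] the monomial in row [i0] and [P] the other n - 1 rows. The factor 1 -
    u_00^2 left over yields the difference in [a]. *)
Lemma corner_moment_step a b c : ~~ odd c ->
  c.+1%:R * (corner_moment a b c - corner_moment a.+2 b c) =
  (n.-1 + c)%:R * corner_moment a b c.+2.
Proof.
move=> /even_halfK <-; set h := c./2.
pose F (M : mxMeas R n) := (M : 'M[R]_n) i0 i0 ^+ a * (M : 'M[R]_n) i0 i1 ^+ b.
have bF : orth_bounded F by exact: orth_boundedM.
have := Ex_column_step i1 i0 (predC1 i0) F h _ bF _.
rewrite cardC1 card_ord => <-; last 2 first.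
- by rewrite /= eq_sym.
- by move=> M N MN; rewrite /F !MN//= negbK.
congr (_ * _); rewrite /corner_moment -[X in _ - X]mul1r -mulNr -ExZ// -ExD//; last first.
  by apply: orth_boundedM => //; exact: orth_bounded_cst.
apply: eq_Ex => M _; rewrite (big_pred1 i0); last by move=> k; rewrite /= negbK.
by rewrite /F -addn2 exprD; ring.
Qed.

End OrthogonalIntegral.

(** * The closed form and its characterisation by the recursions *)

Lemma dfact_neq0 (R : numDomainType) m : (dfact m)%:R != 0 :> R.
Proof.
(* The recursion of [dfact] jumps by two, so the induction carries two consecutive values. *)
suff [] : (0 < dfact m)%N /\ (0 < dfact m.+1)%N by rewrite pnatr_eq0 lt0n.
by elim: m => // m [m0 m1]; split; rewrite //= muln_gt0.
Qed.

Lemma dfactSS (R : numDomainType) m : (dfact m.+2)%:R = m.+1%:R * (dfact m)%:R :> R.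
Proof. by rewrite -natrM. Qed.

(** Here m = n - 2. This is the claimed value of [Phi] divided by its normalising factor, with [b]
    and [c] renamed so that they are the exponents of u_01 and u_10; the formula is symmetric in
    them. *)
Definition corner_value (R : realType) (m a b c : nat) : R :=
  (dfact m.+1)%:R * (dfact m)%:R * ((dfact a)%:R * (dfact b)%:R * (dfact c)%:R) *
  (dfact (b + c + m))%:R /
  ((dfact (b + m))%:R * (dfact (c + m))%:R * (dfact (a + b + c + m.+1))%:R).

Section ClosedForm.
Context (R : realType) (m : nat).
Local Notation V := (corner_value R m).

Lemma corner_value_sphere a : a.+1%:R * V a 0 0 = (m.+2 + a)%:R * V a.+2 0 0.
Proof.
rewrite /corner_value !addn0 !add0n /= !dfactSS.
have -> : (m.+2 + a = (a + m.+1).+1)%N by lia.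
have := dfact_neq0 R; move=> d0; field.
by rewrite !d0 !nat1r -natrD nat1r pnatr_eq0.
Qed.

Lemma corner_value_step a b c :
  c.+1%:R * (V a b c - V a.+2 b c) = (m.+1 + c)%:R * V a b c.+2.
Proof.
rewrite /corner_value.
have -> : (b + c.+2 + m = (b + c + m).+2)%N by lia.
have -> : (c.+2 + m = (c + m).+2)%N by lia.
have -> : (a.+2 + b + c + m.+1 = (a + b + c + m.+1).+2)%N by lia.
have -> : (a + b + c.+2 + m.+1 = (a + b + c + m.+1).+2)%N by lia.
rewrite !(dfactSS R (_ + _)) !(dfactSS R a) !(dfactSS R c).
have := dfact_neq0 R; move=> d0.
have -> : (m.+1 + c)%:R = (c + m).+1%:R :> R by congr (_%:R); lia.
(* With s = a+b+c+m+2, the left side carries 1 - (a+1)/s, which this splitting turns into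
   (b+c+m+1)/s. *)
have -> : (a + b + c + m.+1).+1%:R = a.+1%:R + (b + c + m).+1%:R :> R.
  by rewrite -natrD; congr (_%:R); lia.
field.
by rewrite !d0 -!natrD !nat1r -!natrD !pnatr_eq0.
Qed.

(** The sphere relation gives K(a,0,0), the step relation then K(a,0,c), symmetry K(a,b,0), and the
    step relation again K(a,b,c). *)
Lemma corner_value_unique (K : nat -> nat -> nat -> R) :
  K 0%N 0%N 0%N = 1 ->
  (forall a b c, K a b c = K a c b) ->
  (forall a, ~~ odd a -> a.+1%:R * K a 0%N 0%N = (m.+2 + a)%:R * K a.+2 0%N 0%N) ->
  (forall a b c, ~~ odd c ->
     c.+1%:R * (K a b c - K a.+2 b c) = (m.+1 + c)%:R * K a b c.+2) ->
  forall a b c, ~~ odd a -> ~~ odd b -> ~~ odd c -> K a b c = V a b c.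
Proof.
move=> K0 KC Ksph Kstep.
(* Raising [c] by 2 uses the values at both [a] and a + 2, so the claim is kept for all first
   arguments at once. *)
have induct b : (forall h, K h.*2 b 0%N = V h.*2 b 0%N) ->
    forall k h, K h.*2 b k.*2 = V h.*2 b k.*2.
  move=> Kb; elim=> [//|k IHk] h.
  have kn0 : (m.+1 + k.*2)%:R != 0 :> R by rewrite pnatr_eq0.
  apply: (mulfI kn0); rewrite doubleS -Kstep ?odd_double// -corner_value_step.
  by rewrite IHk -doubleS IHk.
have K00 h : K h.*2 0%N 0%N = V h.*2 0%N 0%N.
  elim: h => [|h IHh].
    have d0 := dfact_neq0 R.
    by rewrite K0 /corner_value !add0n !mulr1; field; rewrite !d0.
  have hn0 : (m.+2 + h.*2)%:R != 0 :> R by rewrite pnatr_eq0.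
  by apply: (mulfI hn0); rewrite doubleS -Ksph ?odd_double// -corner_value_sphere IHh.
have VC a b : V a 0 b = V a b 0.
  by rewrite /corner_value !addn0 !add0n; congr (_ * _ / _); ring.
move=> a b c /even_halfK <- /even_halfK <- /even_halfK <-.
by apply: (induct _ _) => h; rewrite KC (induct 0%N)// VC.
Qed.

End ClosedForm.

(** * Back to [I_int] and [Phi] *)

Lemma ent_ord (R : realType) (n : nat) (M : 'M[R]_n) (i j : 'I_n) : ent M i j = M i j.
Proof. by rewrite /ent !valK. Qed.

(** The exponent of u_01 is [c] and that of u_10 is [b], hence the argument order [a c b]. *)
Lemma I_int_corner (R : realType) (m : nat) (mu : probability (mxMeas R m.+2) R)
    (hmu : is_Haar_On mu) (a b c : nat) :
  I_int mu [:: a; c] [:: b; 0%N] =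
  (corner_moment R m.+2 mu ord0 (lift ord0 ord0) a c b)%:E.
Proof.
rewrite /corner_moment /Rintegral fineK; last first.
  apply: integrable_fin_num; first exact: measurable_orth_group.
  apply: orth_bounded_integrable => //.
  by do ?[apply: orth_boundedM|apply: orth_boundedX|exact: orth_bounded_entry].
apply: eq_integral => M _; rewrite big_ord_recl big_ord1 /=.
rewrite -(ent_ord _ _ _ ord0 ord0) -(ent_ord _ _ _ ord0 (lift _ _)).
by rewrite -(ent_ord _ _ _ (lift _ _) ord0) mulr1 mulrAC.
Qed.

Theorem theorem4p3 (R : realType) (n : nat) (hn : (2 <= n)%N)
    (mu : probability (mxMeas R n) R) (hmu : is_Haar_On mu)
    (a b c : nat) (ha : ~~ odd a) (hb : ~~ odd b) (hc : ~~ odd c) :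
  Phi mu [:: a; c] [:: b; 0%N] =
  (((dfact (n - 1))%:R / (dfact (n - 2))%:R)
   * (((dfact (a + c + n - 2))%:R * (dfact (b + c + n - 2))%:R)
      / ((dfact (c + n - 2))%:R * (dfact (a + b + c + n - 1))%:R)) : R)%:E.
Proof.
(* Writing n = m + 2 removes the truncated subtractions. *)
case: n hn mu hmu => [|[|m]]// _ mu hmu.
rewrite /Phi I_int_corner// -EFinM; congr (_%:E).
rewrite (corner_value_unique R m (corner_moment R m.+2 mu ord0 (lift ord0 ord0)))//.
- rewrite /corner_value ![sumn _]/= !big_cons !big_nil [dfact 0]/= !addn0 !addnS !subSS !subn0.
  rewrite (addnC c b) (addnAC a c b).
  by have d0 := dfact_neq0 R; field; rewrite !d0.
- exact: (corner_moment0 _ _ _ hmu).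
- exact: (corner_momentC _ _ _ hmu).
- exact: (corner_moment_sphere _ _ _ hmu).
- exact: (corner_moment_step _ _ _ hmu).
Qed.
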